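(* Let $(G,\tau)$ be a non-discrete Hausdorff (respectively Hausdorff Abelian) topological group. The following assertions are equivalent: (i) $(G,\tau)$ is an $s$-group; (ii) $(G,\tau)$ is (topologically isomorphic to) a quotient group of a Graev free (respectively Graev free Abelian) topological group over a metrizable space; (iii) $(G,\tau)$ is (topologically isomorphic to) a quotient group of a Graev free (respectively Graev free Abelian) topological group over a Fréchet–Urysohn Tychonoff space; (iv) $(G,\tau)$ is (topologically isomorphic to) a quotient group of a Graev free (respectively Graev free Abelian) topological group over a sequential Tychonoff space.
   Context: A set $S$ of sequences in a group $G$ is a $T_s$-set of sequences if there is a Hausdorff group topology on $G$ in which all sequences of $S$ converge to the unit $e_G$; then $\tau_S$ denotes the finest Hausdorff group topology on $G$ with this property. A Hausdorff topological group $(G,\tau)$ is an $s$-group if $\tau=\tau_S$ for some $T_s$-set $S$ of sequences in $G$. Let $X$ be a Tychonoff space with a fixed basepoint $e\in X$. The Graev free topological group over $X$ is a topological group $F(X)$ such that: (1) there is a continuous mapping $i:X\to F(X)$ with $i(e)=e_{F(X)}$ and $i(X)$ algebraically generates $F(X)$; (2) for every continuous mapping $f:X\to G$ to a topological group $G$ with $f(e)=e_G$ there is a continuous homomorphism $\bar f:F(X)\to G$ with $f=\bar f\circ i$. The Graev free Abelian topological group $A(X)$ is defined similarly with Abelian topological groups in place of topological groups. It is known that $i$ is a topological embedding with closed image. A space is sequential if a subset $A$ is open exactly when it is sequentially open, i.e. whenever a sequence converges to a point of $A$, all but finitely many of its members lie in $A$. A space is Fréchet–Urysohn if for any point $x$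 in the closure of any subset $E$ there is a sequence in $E$ converging to $x$. *)

(* Defs.v *)
From HB Require Import structures.
From mathcomp Require Import all_boot all_order all_algebra.
From mathcomp Require Import all_classical reals topology normedtype.

Set Implicit Arguments.
Unset Strict Implicit.
Unset Printing Implicit Defensive.

Local Open Scope classical_set_scope.
Local Open Scope group_scope.
Local Open Scope quotient_scope.

HB.mixin Record isTopologicalGroup G & Topological G & Group G := {
  mulg_continuous : continuous (fun p : G * G => p.1 * p.2);
  invg_continuous : continuous (fun x : G => x^-1)
}.

#[short(type="topologicalGroupType")]
HB.structure Definition TopologicalGroup :=
  {G of Topological G & Group G & isTopologicalGroup G}.

Definition abelian_group (G : groupType) : Prop :=
  commutative (fun x y : G => x * y).

Definition is_subgroup (G : groupType) (A : set G) : Prop :=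
  [/\ A 1, (forall x y, A x -> A y -> A (x * y)) & (forall x, A x -> A x^-1)].

Record normal_subgroup (G : groupType) := NormalSubgroup {
  normal_carrier : set G;
  normal_is_subgroup : is_subgroup normal_carrier;
  normal_conj : forall x y, normal_carrier x -> normal_carrier (x ^ y)
}.

Section CosetRelation.
Variables (G : groupType) (N : normal_subgroup G).

Definition coset_rel (x y : G) : bool := `[< normal_carrier N (x^-1 * y) >].

Lemma coset_rel_refl : reflexive coset_rel.
Proof.
by move=> x; apply/asboolP; rewrite mulVg; case: (normal_is_subgroup N).
Qed.

Lemma coset_rel_sym : symmetric coset_rel.
Proof.
have [_ _ NV] := normal_is_subgroup N.
by move=> x y; apply/asboolP/asboolP => /NV; rewrite invgM invgK.
Qed.

Lemma coset_rel_trans : transitive coset_rel.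
Proof.
have [_ NM _] := normal_is_subgroup N.
move=> y x z /asboolP xy /asboolP yz; apply/asboolP.
by have := NM _ _ xy yz; rewrite mulgA -(mulgA x^-1) mulgV mulg1.
Qed.

Canonical coset_equiv :=
  EquivRel coset_rel coset_rel_refl coset_rel_sym coset_rel_trans.

End CosetRelation.

(* [quotient_topology] carries the finest topology making the canonical
   projection [\pi] continuous. *)
Definition quotient_group (G : topologicalGroupType) (N : normal_subgroup G) :=
  quotient_topology {eq_quot coset_equiv N}.

Section QuotientGroup.
Variables (G : topologicalGroupType) (N : normal_subgroup G).
Local Notation Q := (quotient_group N).

HB.instance Definition _ := Topological.on Q.
HB.instance Definition _ := Quotient.on Q.

Let pi (x : G) : Q := \pi_Q x.

Let piP x y : pi x = pi y <-> normal_carrier N (x^-1 * y).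
Proof.
split=> [xy|xy].
  apply/asboolP; rewrite -/(coset_rel N x y).
  by have /eqmodP := xy.
by apply/eqmodP; apply/asboolP.
Qed.

Let pi_repr (q : Q) : pi (repr q) = q.
Proof. exact: reprK. Qed.

Definition quotient_one : Q := \pi_Q 1.
Definition quotient_mul (p q : Q) : Q := \pi_Q (repr p * repr q).
Definition quotient_inv (p : Q) : Q := \pi_Q (repr p)^-1.

Let piM x y : quotient_mul (pi x) (pi y) = pi (x * y).
Proof.
have [_ NM _] := normal_is_subgroup N.
have /piP Nx := pi_repr (pi x); have /piP Ny := pi_repr (pi y).
apply/piP; rewrite invgM -mulgA.
set a := repr (pi x) in Nx *; set b := repr (pi y) in Ny *.
have -> : b^-1 * (a^-1 * (x * y)) = (b^-1 * y) * ((a^-1 * x) ^ y).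
  by rewrite /conjg !mulgA -(mulgA b^-1 y y^-1) mulgV mulg1.
by apply: NM => //; apply: normal_conj.
Qed.

Let piV x : quotient_inv (pi x) = pi x^-1.
Proof.
have [_ _ NV] := normal_is_subgroup N.
have /piP Nx := pi_repr (pi x).
apply/piP; set a := repr (pi x) in Nx *.
rewrite invgK.
have -> : a * x^-1 = (((a^-1 * x)^-1) ^ x^-1).
  by rewrite /conjg invgM !invgK !mulgA mulgV mul1g.
by apply: normal_conj; apply: NV.
Qed.

Let quotient_mulA : associative quotient_mul.
Proof.
move=> p q r; rewrite -(pi_repr p) -(pi_repr q) -(pi_repr r).
by rewrite !piM mulgA.
Qed.

Let quotient_mul1 : left_id quotient_one quotient_mul.
Proof. by move=> p; rewrite -(pi_repr p) [quotient_mul _ _]piM mul1g. Qed.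

Let quotient_mulr1 : right_id quotient_one quotient_mul.
Proof. by move=> p; rewrite -(pi_repr p) [quotient_mul _ _]piM mulg1. Qed.

Let quotient_mulV : left_inverse quotient_one quotient_inv quotient_mul.
Proof. by move=> p; rewrite -(pi_repr p) piV piM mulVg. Qed.

Let quotient_mulrV : right_inverse quotient_one quotient_inv quotient_mul.
Proof. by move=> p; rewrite -(pi_repr p) piV piM mulgV. Qed.

HB.instance Definition _ := isGroup.Build Q quotient_mulA quotient_mul1
  quotient_mulr1 quotient_mulV quotient_mulrV.

Lemma quotient_piM (x y : G) : \pi_Q (x * y) = \pi_Q x * \pi_Q y :> Q.
Proof. exact: (esym (piM _ _)). Qed.

Lemma quotient_piV (x : G) : \pi_Q x^-1 = (\pi_Q x)^-1 :> Q.
Proof. exact: (esym (piV _)). Qed.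

Let mulgr_continuous (n : G) : continuous (fun x : G => x * n).
Proof.
move=> x; apply: (@continuous_comp _ _ _ (fun x : G => (x, n))
  (fun p : G * G => p.1 * p.2)); last exact: mulg_continuous.
by apply: cvg_pair => /=; [exact: cvg_id|exact: cvg_cst].
Qed.

Lemma quotient_pi_open (A : set G) : open A -> open ((\pi_Q : G -> Q) @` A).
Proof.
move=> oA; rewrite /open/= /quotient_open.
have -> : (\pi_Q : G -> Q) @^-1` ((\pi_Q : G -> Q) @` A) =
    \bigcup_(n in normal_carrier N) ((fun x : G => x * n) @^-1` A).
  apply/seteqP; split=> [x [a Aa /esym/piP Nxa]|x [n Nn Axn]] /=.
    by exists (x^-1 * a) => //=; rewrite mulgA mulgV mul1g.
  by exists (x * n) => //; apply/esym/piP; rewrite mulgA mulVg mul1g.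
by apply: bigcup_open => n _; move/continuousP: (@mulgr_continuous n); apply.
Qed.

Let nbhs_pi (x : G) (A : set G) :
  nbhs x A -> nbhs (\pi_Q x : Q) ((\pi_Q : G -> Q) @` A).
Proof.
rewrite !nbhsE => -[B [oB Bx] BA].
exists ((\pi_Q : G -> Q) @` B); last exact: image_subset.
by split; [exact: quotient_pi_open|exists x].
Qed.

Let quotient_mul_continuous : continuous (fun p : Q * Q => p.1 * p.2).
Proof.
move=> [p q] U /= Upq.
rewrite -(reprK p) -(reprK q) -quotient_piM in Upq.
have nU : nbhs (repr p * repr q) ((\pi_Q : G -> Q) @^-1` U).
  exact: (@pi_continuous G {eq_quot coset_equiv N}).
have [[A B] /= [nA nB] AB] := @mulg_continuous G (repr p, repr q) _ nU.
exists ((\pi_Q : G -> Q) @` A, (\pi_Q : G -> Q) @` B) => /=.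
  by split; [rewrite -(reprK p)|rewrite -(reprK q)]; exact: nbhs_pi.
move=> [_ _] /= [[a Aa <-] [b Bb <-]].
by rewrite -quotient_piM; exact: (AB (a, b)).
Qed.

Let quotient_inv_continuous : continuous (fun x : Q => x^-1).
Proof.
move=> p U /= Up; rewrite -(reprK p) -quotient_piV in Up.
have nU : nbhs (repr p)^-1 ((\pi_Q : G -> Q) @^-1` U).
  exact: (@pi_continuous G {eq_quot coset_equiv N}).
have := nbhs_pi (@invg_continuous G (repr p) _ nU);
  rewrite reprK; apply: filterS => _ [a Ua <-] /=.
by rewrite -quotient_piV.
Qed.

HB.instance Definition _ := isTopologicalGroup.Build Q
  quotient_mul_continuous quotient_inv_continuous.

End QuotientGroup.

Definition top_isomorphic (G H : topologicalGroupType) : Prop :=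
  exists (f : G -> H) (g : H -> G),
    [/\ {morph f : x y / x * y}, cancel f g, cancel g f,
        continuous f & continuous g].

Definition is_group_topology (G : groupType) (t : Topological G) : Prop :=
  let T : topologicalType := Topological.Pack t in
  continuous ((fun p => (p.1 : G) * (p.2 : G)) : T * T -> T) /\
  continuous ((fun x => (x : G)^-1) : T -> T).

Section SGroups.
Variables (G : groupType) (S : set (nat -> G)).

Definition Ts_topology (t : Topological G) : Prop :=
  let T : topologicalType := Topological.Pack t in
  [/\ is_group_topology t, hausdorff_space T &
      forall u : nat -> T, S u -> u @ \oo --> ((1 : G) : T)].

Definition Ts_set : Prop := exists t, Ts_topology t.

(* [t] is the topology tau_S *)
Definition finest_Ts_topology (t : Topological G) : Prop :=
  Ts_topology t /\
  forall t', Ts_topology t' ->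
    @open (Topological.Pack t') `<=` @open (Topological.Pack t).

End SGroups.

Definition s_group (G : topologicalGroupType) : Prop :=
  hausdorff_space G /\
  exists S : set (nat -> G),
    Ts_set S /\ finest_Ts_topology S (Topological.class G).

Definition discrete_space (X : topologicalType) : Prop :=
  forall A : set X, open A.

Definition tychonoff_space (X : topologicalType) : Prop :=
  completely_regular_space X /\ hausdorff_space X.

Definition metrizable (R : realType) (X : topologicalType) : Prop :=
  exists m : Metric R X, @open X = @open (Metric.Pack m).

Definition sequentially_open (X : topologicalType) (A : set X) : Prop :=
  forall (u : nat -> X) (x : X), A x -> u @ \oo --> x ->
    \forall n \near \oo, A (u n).

Definition sequential_space (X : topologicalType) : Prop :=
  forall A : set X, open A <-> sequentially_open A.

Definition frechet_urysohn_space (X : topologicalType) : Prop :=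
  forall (E : set X) (x : X), closure E x ->
    exists u : nat -> X, (forall n, E (u n)) /\ u @ \oo --> x.

(* The Graev free object over the pointed space (X, e) among the topological
   groups satisfying C.  As in the classical definition, the test groups [H] of
   the universal property are not assumed to be Hausdorff. *)
Definition graev_free_in (C : topologicalGroupType -> Prop)
    (X : topologicalType) (e : X) (F : topologicalGroupType) (i : X -> F)
    : Prop :=
  [/\ C F,
      [/\ continuous i, i e = 1 &
          smallest (@is_subgroup F) (range i) = [set: F]] &
      forall (H : topologicalGroupType) (f : X -> H),
        C H -> continuous f -> f e = 1 ->
        exists g : F -> H,
          [/\ {morph g : x y / x * y}, continuous g & f = g \o i]].

Definition graev_free := graev_free_in (fun=> True).

Definition graev_free_abelian :=
  graev_free_in (fun G : topologicalGroupType => abelian_group G).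

Definition quotient_of_graev_free (P : topologicalType -> Prop)
    (G : topologicalGroupType) : Prop :=
  exists (X : topologicalType) (e : X) (F : topologicalGroupType)
    (i : X -> F) (N : normal_subgroup F),
    [/\ P X, graev_free e i & top_isomorphic (quotient_group N) G].

Definition quotient_of_graev_free_abelian (P : topologicalType -> Prop)
    (G : topologicalGroupType) : Prop :=
  exists (X : topologicalType) (e : X) (F : topologicalGroupType)
    (i : X -> F) (N : normal_subgroup F),
    [/\ P X, graev_free_abelian e i & top_isomorphic (quotient_group N) G].

(* Main.v *)
(* [G] is an s-group iff its topology contains every Hausdorff group topology in
   which all sequences of [G] converging to [1] still converge to [1].

   From (iv) to (i): if [t] is such a topology and [X] is sequential, then the
   map from [X] to [(G, t)] is sequentially continuous, hence continuous, hence
   it extends to the free group; so the quotient topology contains [t].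

   From (i) to (ii): take for [X] the metrizable disjoint sum of one convergent
   sequence for each sequence of [G] converging to [1], the limit points being
   sent to [1]. Every [y] occurs as the first term of [y, 1, 1, ...], so the
   free group over [X] maps onto [G]. The quotient topology so obtained on [G]
   keeps all these sequences convergent, hence is contained in the topology
   of [G].

   The free group is realized as the words in [X] modulo equality under all maps
   into groups of the class at hand, with the supremum of the group topologies
   that make the generators continuous. *)

Require Import Defs.
From HB Require Import structures.
From mathcomp Require Import all_boot all_order all_algebra.
From mathcomp Require Import all_classical reals topology normedtype.
From mathcomp Require Import interval_inference lra.

Set Implicit Arguments.
Unset Strict Implicit.
Unset Printing Implicit Defensive.

Import Order.TTheory GRing.Theory Num.Theory.

Local Open Scope classical_set_scope.
Local Open Scope group_scope.
Local Open Scope quotient_scope.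

(** * Group topologies: pullbacks, change of topology, suprema *)

Lemma morph1 (G H : groupType) (f : G -> H) :
  {morph f : x y / x * y} -> f 1 = 1.
Proof. by move=> fM; apply: (mulgI (f 1)); rewrite -fM !mulg1. Qed.

Lemma morphV (G H : groupType) (f : G -> H) :
  {morph f : x y / x * y} -> {morph f : x / x^-1}.
Proof.
by move=> fM x; apply: (mulgI (f x)); rewrite -fM !mulgV (morph1 fM).
Qed.

Lemma topological_mulg_continuous (G : topologicalGroupType) (a : G) :
  continuous (fun x : G => a * x).
Proof.
move=> x; apply: (@continuous_comp _ _ _ (fun x : G => (a, x))
  (fun p : G * G => p.1 * p.2)); last exact: mulg_continuous.
by apply: cvg_pair => /=; [exact: cvg_cst|exact: cvg_id].
Qed.

(** Composing the operations with the homomorphism [f] turns them into those of [H], which are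
    continuous. *)
Lemma initial_group_topology (G : groupType) (H : topologicalGroupType)
    (f : G -> H) :
  {morph f : x y / x * y} ->
  is_group_topology (Topological.class (initial_topology f)).
Proof.
move=> fM; pose W := initial_topology f.
have fc : continuous (f : W -> H) by exact: initial_continuous.
split.
- apply/(@continuous_comp_initial (W : choiceType)) => p /=.
  rewrite (_ : f \o _ = (fun p : W * W => (f p.1 : H) * f p.2)); last first.
    by apply/funext => q /=; rewrite fM.
  apply: (@continuous_comp _ _ _ (fun p : W * W => (f p.1 : H, f p.2 : H))
    (fun p : H * H => p.1 * p.2)); last exact: mulg_continuous.
  apply: cvg_pair => /=.
    by apply: (@continuous_comp _ _ _ fst (f : W -> H));
      [exact: cvg_fst|exact: fc].
  by apply: (@continuous_comp _ _ _ snd (f : W -> H));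
    [exact: cvg_snd|exact: fc].
- apply/(@continuous_comp_initial (W : choiceType)) => p /=.
  rewrite (_ : f \o _ = (fun p : W => (f p : H)^-1)); last first.
    by apply/funext => q /=; rewrite (morphV fM).
  by apply: (@continuous_comp _ _ _ (f : W -> H));
    [exact: fc|exact: invg_continuous].
Qed.

Section Retopologized.
Variables (G : groupType) (t : Topological G).

(** An alias of [G], so that a group that already has a topology can carry [t] without a clash of
    instances. *)
Definition retopologized : Type := G.

HB.instance Definition _ := Topological.copy retopologized (Topological.Pack t).
HB.instance Definition _ := isGroup.Build retopologized
  (@mulgA G) (@mul1g G) (@mulg1 G) (@mulVg G) (@mulgV G).

Hypothesis tG : is_group_topology t.

Let retopologized_mulg :
  continuous (fun p : retopologized * retopologized => p.1 * p.2).
Proof. exact: tG.1. Qed.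

Let retopologized_invg : continuous (fun x : retopologized => x^-1).
Proof. exact: tG.2. Qed.

(** Transparent, so that maps to or from [G] are maps to or from the new group by conversion. *)
Definition retopologized_group : topologicalGroupType.
Proof.
pose m := isTopologicalGroup.Build retopologized
  retopologized_mulg retopologized_invg.
exact: (HB.pack_for topologicalGroupType retopologized m).
Defined.

End Retopologized.

Section SupGroupTopology.
Variables (G : groupType) (I : Type) (t : I -> Topological G).
Hypothesis tG : forall i, is_group_topology (t i).

Lemma sup_continuous i :
  continuous (id : sup_topology t -> Topological.Pack (t i)).
Proof.
move=> x; have /(cvg_sup t) := @cvg_id _ (nbhs (x : sup_topology t)).
exact.
Qed.

Lemma sup_group_topology :
  is_group_topology (Topological.class (sup_topology t)).
Proof.
pose S := sup_topology t; split.
- change (continuous (fun p : S * S => (p.1 : G) * (p.2 : G) : S)).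
  move=> p; apply/cvg_sup => i.
  apply: (@continuous_comp _ _ _
    (fun p : sup_topology t * sup_topology t =>
       (p.1 : Topological.Pack (t i), p.2 : Topological.Pack (t i)))
    (fun p => (p.1 : G) * (p.2 : G) : Topological.Pack (t i))).
    apply: cvg_pair => /=.
      apply: (@continuous_comp (S * S)%type S (Topological.Pack (t i)) fst id);
        [exact: cvg_fst|exact: sup_continuous].
    apply: (@continuous_comp (S * S)%type S (Topological.Pack (t i)) snd id);
        [exact: cvg_snd|exact: sup_continuous].
  exact: (tG i).1.
- change (continuous (fun x : S => (x : G)^-1 : S)).
  move=> p; apply/(@cvg_sup _ _ t _ _ (fmap_filter _ (nbhs_filter p))) => i.
  apply: (@continuous_comp S (Topological.Pack (t i))
    (Topological.Pack (t i)) id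
    (fun x => (x : G)^-1 : Topological.Pack (t i))).
    exact: sup_continuous.
  exact: (tG i).2.
Qed.

End SupGroupTopology.

(* Satisfied by the class of all groups and by that of abelian groups. *)
Definition residually_closed (C : groupType -> Prop) : Prop :=
  forall G : groupType,
    (forall x y : G,
      (forall (H : groupType) (f : G -> H), C H ->
        {morph f : a b / a * b} -> f x = f y) -> x = y) ->
    C G.

(** * Free groups over a pointed set, relative to a class [C] *)

Section FreeGroup.
Variables (C : groupType -> Prop) (X : choiceType) (e : X).

Definition letter_eval (H : groupType) (f : X -> H) (l : X * bool) : H :=
  if l.2 then (f l.1)^-1 else f l.1.

Definition word_eval (H : groupType) (f : X -> H) (w : seq (X * bool)) : H :=
  foldr (fun l h => letter_eval f l * h) 1 w.

Definition word_inv (w : seq (X * bool)) : seq (X * bool) :=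
  rev [seq (l.1, ~~ l.2) | l <- w].

Lemma word_eval_cat (H : groupType) (f : X -> H) v w :
  word_eval f (v ++ w) = word_eval f v * word_eval f w.
Proof. by elim: v => [|l v IHv] /=; rewrite ?mul1g// IHv mulgA. Qed.

Lemma word_eval_inv (H : groupType) (f : X -> H) w :
  word_eval f (word_inv w) = (word_eval f w)^-1.
Proof.
elim: w => [|[x b] w IHw]; first by rewrite invg1.
rewrite /word_inv /= rev_cons -cats1 word_eval_cat [word_eval f (rev _)]IHw.
by rewrite /= mulg1 invgM /letter_eval; case: b; rewrite /= ?invgK.
Qed.

(** Testing words in all groups of [C] treats every class [C] at once, without reduced words; the
    condition [f e = 1] makes the base point trivial. *)
Definition word_equiv (v w : seq (X * bool)) : bool :=
  `[< forall (H : groupType) (f : X -> H), C H -> f e = 1 ->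
      word_eval f v = word_eval f w >].

Lemma word_equiv_refl : reflexive word_equiv.
Proof. by move=> w; apply/asboolP. Qed.

Lemma word_equiv_sym : symmetric word_equiv.
Proof.
by move=> v w; apply/asboolP/asboolP => vw H f CH fe; rewrite (vw H f CH fe).
Qed.

Lemma word_equiv_trans : transitive word_equiv.
Proof.
move=> v u w /asboolP uv /asboolP vw; apply/asboolP => H f CH fe.
by rewrite (uv H f CH fe) (vw H f CH fe).
Qed.

Canonical word_equiv_rel :=
  EquivRel word_equiv word_equiv_refl word_equiv_sym word_equiv_trans.

Definition free_group : Type := {eq_quot word_equiv_rel}.

HB.instance Definition _ := Quotient.copy free_group {eq_quot word_equiv_rel}.
HB.instance Definition _ := Choice.copy free_group {eq_quot word_equiv_rel}.

Let pi (w : seq (X * bool)) : free_group := \pi_free_group w.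

Let piP v w : (forall (H : groupType) (f : X -> H), C H -> f e = 1 ->
  word_eval f v = word_eval f w) <-> pi v = pi w.
Proof.
split=> [vw|vw]; first by apply/eqmodP; apply/asboolP.
by have /eqmodP/asboolP := vw.
Qed.

Let pi_repr (q : free_group) : pi (repr q) = q.
Proof. exact: reprK. Qed.

Definition free_one : free_group := pi [::].
Definition free_mul (p q : free_group) : free_group := pi (repr p ++ repr q).
Definition free_inv (p : free_group) : free_group := pi (word_inv (repr p)).

Let piM v w : free_mul (pi v) (pi w) = pi (v ++ w).
Proof.
apply/piP => H f CH fe; rewrite !word_eval_cat.
by congr (_ * _); apply: (piP _ _).2 => //; exact: pi_repr.
Qed.

Let piV w : free_inv (pi w) = pi (word_inv w).
Proof.
apply/piP => H f CH fe; rewrite !word_eval_inv.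
by congr (_^-1); apply: (piP _ _).2 => //; exact: pi_repr.
Qed.

Let free_mulA : associative free_mul.
Proof.
move=> p q r; rewrite -(pi_repr p) -(pi_repr q) -(pi_repr r).
by rewrite !piM catA.
Qed.

Let free_mul1 : left_id free_one free_mul.
Proof. by move=> p; rewrite -(pi_repr p) piM. Qed.

Let free_mulr1 : right_id free_one free_mul.
Proof. by move=> p; rewrite -(pi_repr p) piM cats0. Qed.

Let free_mulV : left_inverse free_one free_inv free_mul.
Proof.
move=> p; rewrite -(pi_repr p) piV piM; apply/piP => H f CH fe.
by rewrite word_eval_cat word_eval_inv mulVg.
Qed.

Let free_mulrV : right_inverse free_one free_inv free_mul.
Proof.
move=> p; rewrite -(pi_repr p) piV piM; apply/piP => H f CH fe.
by rewrite word_eval_cat word_eval_inv mulgV.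
Qed.

HB.instance Definition _ := isGroup.Build free_group free_mulA free_mul1
  free_mulr1 free_mulV free_mulrV.

Definition free_gen (x : X) : free_group := pi [:: (x, false)].

(** If [C H] and [f e = 1], [word_equiv] makes the value independent of the representative. *)
Definition free_lift (H : groupType) (f : X -> H) (p : free_group) : H :=
  word_eval f (repr p).

Let free_lift_pi (H : groupType) (f : X -> H) w : C H -> f e = 1 ->
  free_lift f (pi w) = word_eval f w.
Proof. by move=> CH fe; apply: (piP _ _).2 => //; exact: pi_repr. Qed.

Lemma free_liftM (H : groupType) (f : X -> H) : C H -> f e = 1 ->
  {morph free_lift f : x y / x * y}.
Proof.
move=> CH fe p q; rewrite -(pi_repr p) -(pi_repr q).
rewrite [_ (pi _) (pi _)]piM.
by rewrite !free_lift_pi// word_eval_cat.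
Qed.

Lemma free_lift_gen (H : groupType) (f : X -> H) : C H -> f e = 1 ->
  forall x, free_lift f (free_gen x) = f x.
Proof. by move=> CH fe x; rewrite free_lift_pi//= mulg1. Qed.

Lemma free_gen1 : free_gen e = 1.
Proof. by apply/piP => H f CH fe /=; rewrite mulg1. Qed.

Lemma free_group_generated (A : set free_group) :
  is_subgroup A -> range free_gen `<=` A -> A = [set: free_group].
Proof.
move=> [A1 AM AV] genA; apply/seteqP; split=> // p _.
rewrite -(pi_repr p); elim: (repr p) => [//|[x b] w IHw].
rewrite -[pi _](piM [:: (x, b)] w); apply: AM => //.
have Ax : A (free_gen x) by apply: genA; exists x.
by case: b => //; have := AV _ Ax; rewrite [_^-1]piV.
Qed.

(** The lifts [free_lift f] are homomorphisms into groups of [C], and by construction they separate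
    the classes of words. *)
Lemma free_group_in : residually_closed C -> C free_group.
Proof.
move=> hC; apply: hC => p q pq; rewrite -(pi_repr p) -(pi_repr q).
apply/piP => H f CH fe.
exact: (pq H (free_lift f) CH (free_liftM CH fe)).
Qed.

End FreeGroup.

(** * The Graev topology on the free group *)

Section GraevFree.
Variables (C : groupType -> Prop) (X : topologicalType) (e : X).
Hypothesis hC : residually_closed C.

Local Notation F := (free_group C e).
Local Notation gen := (@free_gen C X e).

Definition graev_index : Type := {t : Topological F |
  is_group_topology t /\ continuous (gen : X -> Topological.Pack t)}.

Definition graev_topology : Topological F :=
  Topological.class (sup_topology (fun s : graev_index => sval s)).

Lemma graev_topologyP : is_group_topology graev_topology.
Proof. by apply: sup_group_topology => -[t []]. Qed.

Definition graev_group : topologicalGroupType :=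
  retopologized_group graev_topologyP.

Lemma graev_gen_continuous : continuous (gen : X -> graev_group).
Proof.
move=> x; apply/(@cvg_sup _ _ (fun s : graev_index => sval s) _ _
  (fmap_filter _ (nbhs_filter x))) => -[t [tG tc]].
exact: tc.
Qed.

(** The topology of [H] pulled back along the lift is itself one of those in the supremum. *)
Lemma graev_lift_continuous (H : topologicalGroupType) (f : X -> H) :
  C H -> continuous f -> f e = 1 ->
  continuous (free_lift f : graev_group -> H).
Proof.
move=> CH fc fe; pose g : F -> H := free_lift f.
have gM : {morph g : x y / x * y} by exact: free_liftM.
have genc : continuous (gen : X -> initial_topology g).
  apply: continuous_comp_initial.
  by rewrite (_ : _ \o _ = f)//; apply/funext => x; exact: free_lift_gen.
pose s : graev_index :=
  exist _ (Topological.class (initial_topology g))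
    (conj (initial_group_topology gM) genc).
move=> p; apply: (@continuous_comp graev_group (initial_topology g) H id g).
  exact: (@sup_continuous _ _ (fun s : graev_index => sval s) s).
exact: initial_continuous.
Qed.

Lemma graev_groupP :
  graev_free_in (fun G : topologicalGroupType => C G) e
    (gen : X -> graev_group).
Proof.
split.
(* [graev_group] has the operations of the free group but its own [groupType] structure; the
   identity, a homomorphism into a member of [C], separates its points. *)
- apply: hC => p q pq.
  exact: (pq F id (free_group_in e hC) (fun _ _ => erefl)).
- split; [exact: graev_gen_continuous|exact: free_gen1|].
  apply: (@free_group_generated C X e).
  + split=> [A [[]] //|x y Ax Ay A [As gA]|x Ax A [As gA]].
    * by case: (As) => _ AM _; apply: AM; [exact: Ax|exact: Ay].
    * by case: (As) => _ _; apply; exact: Ax.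
  + by move=> _ [x _ <-] A [_]; apply; exists x.
- move=> H f CH fc fe; exists (free_lift f); split.
  + exact: free_liftM.
  + exact: graev_lift_continuous.
  + by apply/funext => x /=; rewrite free_lift_gen.
Qed.

End GraevFree.

(** * Characterization of s-groups, and from (iv) to (i) *)

Lemma eq_open_nbhs (X : Type) (s t : Topological X) :
  @open (Topological.Pack s) = @open (Topological.Pack t) ->
  @nbhs X (Topological.Pack s) = @nbhs X (Topological.Pack t).
Proof.
move=> st; apply/funext => x.
by rewrite (@nbhsE (Topological.Pack s)) (@nbhsE (Topological.Pack t))
  /open_nbhs st.
Qed.

(** [S] may be enlarged to all sequences converging to 1: a topology that keeps these convergent
    keeps those of [S] convergent, so it is among the competitors of the finest one. *)
Lemma s_groupP (G : topologicalGroupType) :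
  s_group G <-> hausdorff_space G /\
    forall t : Topological G, is_group_topology t ->
      hausdorff_space (Topological.Pack t) ->
      (forall u : nat -> G, u @ \oo --> (1 : G) ->
        (u : nat -> Topological.Pack t) @ \oo -->
          ((1 : G) : Topological.Pack t)) ->
      @open (Topological.Pack t) `<=` @open G.
Proof.
split=> [[hG [S [_ [[_ _ SG] fin]]]]|[hG fin]]; split=> //.
  by move=> t tG ht tc; apply: fin; split=> // u Su; exact/tc/SG.
have tS : Ts_topology [set u : nat -> G | u @ \oo --> (1 : G)]
    (Topological.class G).
  split=> //.
  by split; [exact: mulg_continuous|exact: invg_continuous].
exists [set u | u @ \oo --> (1 : G)]; split.
  by exists (Topological.class G).
by split=> // t [tG ht tc]; exact: fin.
Qed.

Lemma sequential_quotient_s_group (C : groupType -> Prop) (X : topologicalType)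
    (e : X) (F : topologicalGroupType) (i : X -> F) (N : normal_subgroup F)
    (G : topologicalGroupType) :
  residually_closed C -> C G -> hausdorff_space G -> sequential_space X ->
  graev_free_in (fun H : topologicalGroupType => C H) e i ->
  top_isomorphic (quotient_group N) G -> s_group G.
Proof.
move=> hC CG hG seqX [_ [ic ie iF] univ] [k [h [kM hK kK kc hc]]].
apply/s_groupP; split=> // t tG ht tc U oU.
pose p (x : F) : G := k (\pi_(quotient_group N) x).
have pM : {morph p : x y / x * y} by move=> x y; rewrite /p quotient_piM kM.
have pc : continuous p.
  by apply/(@quotient_continuous _ _ _ k).
pose H : topologicalGroupType := retopologized_group tG.
have CH : C H.
  by apply: hC => x y xy; exact: (xy G id CG (fun _ _ => erefl)).
pose f : X -> H := p \o i.
have fe : f e = 1 by rewrite /f /= ie (morph1 pM).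
have fc : continuous f.
  apply/continuousP => A oA; apply/seqX => u x Afx ux.
  have pu : (p \o i \o u) n @[n --> \oo] --> p (i x).
    apply: (@continuous_cvg _ _ _ _ _ u (p \o i)) => //.
    by apply: continuous_comp; [exact: ic|exact: pc].
  (* [tc] only concerns the limit 1: the sequence is translated to 1 in [G], converges there for
     [t], and is translated back in [H]. *)
  have := tc (fun n => (p (i x))^-1 * p (i (u n))).
  rewrite -(mulVg (p (i x))) => /(_ (continuous_cvg _
    (@topological_mulg_continuous G (p (i x))^-1 _) pu)) => tu.
  have fK y : f y = (p (i x) : H) * ((p (i x))^-1 * p (i y) : G).
    by rewrite [RHS](@mulVKg G).
  suff tfu : (f \o u) n @[n --> \oo] --> f x.
    by apply: (tfu A); exact: (@open_nbhs_nbhs H).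
  rewrite [f \o u](funext (fun n => fK (u n))) fK.
  exact: (@continuous_cvg _ H H _ _ _ (fun y => p (i x) * y) _
    (@topological_mulg_continuous H (p (i x)) _) tu).
have [g [gM gc gi]] := univ H f CH fc fe.
(* The points where [g] and [p] agree form a subgroup containing the generators. *)
have gp x : g x = p x.
  suff : smallest (@is_subgroup F) (range i) `<=` [set y | g y = p y].
    by rewrite iF => /(_ x I).
  apply: smallest_sub; last first.
    by move=> _ [y _ <-]; rewrite /= -[g _]/((g \o i) y) -gi.
  split=> /=.
  - by rewrite (morph1 gM) (morph1 pM).
  - by move=> a b; rewrite gM pM => -> ->.
  - by move=> a; rewrite (morphV gM) (morphV pM) => ->.
(* Openness is moved along [h] to the quotient and then to [F], where the preimage of the [t]-open
   set [U] is the one under the continuous [g]. *)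
have -> : U = h @^-1` (k @^-1` U) by apply/funext => y /=; rewrite kK.
move/continuousP: hc; apply.
rewrite /open /= /quotient_open.
suff -> : \pi_(quotient_group N) @^-1` (k @^-1` U) = g @^-1` U.
  by move/continuousP: gc; apply.
by apply/funext => x /=; rewrite gp.
Qed.

(** * Metrizable, Fréchet-Urysohn and sequential spaces *)

Lemma frechet_urysohn_sequential (X : topologicalType) :
  frechet_urysohn_space X -> sequential_space X.
Proof.
move=> fu A; split=> [oA u x Ax ux|sA].
  by apply: ux; exact: open_nbhs_nbhs.
(* If [A x] held, a sequence in the complement converging to [x] would eventually lie in [A]. *)
rewrite -closedC => x /fu [u [uA ux]] Ax.
have [N _ /(_ N (leqnn N))] := sA u x Ax ux.
exact: uA.
Qed.

Lemma metrizable_tychonoff (R : realType) (X : topologicalType) :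
  metrizable R X -> tychonoff_space X.
Proof.
move=> [m mX]; pose M : metricType R := Metric.Pack m.
(* [metrizable] equates open sets only, so the neighbourhood filters are matched before facts on [M]
   are used. *)
have XM : @nbhs X X = @nbhs M M.
  exact: (@eq_open_nbhs X (Topological.class X) (Topological.class M)).
split.
  move=> a B cB Ba.
  have cB' : @closed M B.
    by rewrite -openC; rewrite -(openC (T := X)) mX in cB *.
  have [uT [E [entE ABE le]]] := @uniform_completely_regular R M a B cB' Ba.
  by exists uT, E; split=> // x; rewrite XM; exact: le.
by move=> x y; rewrite /cluster XM; exact: (@metric_hausdorff R M).
Qed.

Lemma metrizable_frechet_urysohn (R : realType) (X : topologicalType) :
  metrizable R X -> frechet_urysohn_space X.
Proof.
move=> [m mX]; pose M : metricType R := Metric.Pack m.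
have XM : @nbhs X X = @nbhs M M.
  exact: (@eq_open_nbhs X (Topological.class X) (Topological.class M)).
move=> E x; rewrite /closure XM /= => Ex.
have /choice[u uE] n : exists y, E y /\ @ball R M x n.+1%:R^-1%R y.
  apply: Ex; exact: (@nbhsx_ballx R M).
exists u; split=> [n|]; first by case: (uE n).
move=> U /(@nbhs_ballP R M) [d /= d0 dU].
have [N _ Nd] := near_infty_natSinv_lt (PosNum d0).
exists N => // n /Nd /= nd; apply: dU.
exact: (le_ball (ltW nd) (uE n).2).
Qed.

(* [(i, Some n)] is the [n]-th term of the [i]-th sequence and [(i, None)] its
   limit. The phantom argument [R] is there for the inference of the metric. *)
Definition sequence_sum (R : realType) (I : choiceType) : Type :=
  (I * option nat)%type.

(** * The metric on a disjoint sum of convergent sequences *)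

Section ConvergentSequences.
Variables (R : realType) (I : choiceType).
Local Open Scope ring_scope.

Local Notation S := (sequence_sum R I).


HB.instance Definition _ := Choice.on S.

Definition height (n : option nat) : R :=
  if n is Some k then k.+1%:R^-1 else 0.

Lemma height_itv n : 0 <= height n <= 1.
Proof.
case: n => [n|] /=; last by rewrite lexx ler01.
by rewrite invr_ge0 ler0n invf_le1 ?ler1n ?ltr0n.
Qed.

(** Hedgehog-like: inside one sequence the way between two points runs through the limit, at height
    0; distinct sequences are at distance 1. *)
Definition sequence_dist (x y : S) : R :=
  if x == y then 0 else if x.1 == y.1 then height x.2 + height y.2 else 1.

Lemma sequence_distxx x : sequence_dist x x = 0.
Proof. by rewrite /sequence_dist eqxx. Qed.

Lemma sequence_dist_positivity x y : sequence_dist x y = 0 -> x = y.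
Proof.
rewrite /sequence_dist; case: eqP => [//|]; move: x y => [i m] [j n] /=.
case: eqP => [->|_ _ /eqP]; last by rewrite oner_eq0.
have hgt0 k : 0 < height (Some k) by rewrite /= invr_gt0.
have := height_itv m; have := height_itv n.
case: m n => [m|] [n|] n0 m0 ne h0; last by case: ne.
- by exfalso; have := hgt0 m; have := hgt0 n; lra.
- by exfalso; have := hgt0 m; lra.
- by exfalso; have := hgt0 n; lra.
Qed.

Lemma sequence_dist_sym x y : sequence_dist x y = sequence_dist y x.
Proof. by rewrite /sequence_dist eq_sym [x.1 == _]eq_sym addrC. Qed.

(** Heights at most 1 settle the detour through another sequence: the direct distance is at most 2
    and both legs are 1. *)
Lemma sequence_dist_triangle y x z :
  sequence_dist x z <= sequence_dist x y + sequence_dist y z.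
Proof.
rewrite /sequence_dist.
have := height_itv x.2; have := height_itv y.2; have := height_itv z.2.
case: (eqVneq x y) => [->|nxy]; first by rewrite add0r.
case: (eqVneq y z) => [<-|_]; first by rewrite (negPf nxy) addr0.
case: (eqVneq x z) => [_|_]; case: (eqVneq x.1 y.1) => [xy|xy];
  case: (eqVneq y.1 z.1) => [yz|yz]; try lra.
- by rewrite xy yz eqxx; lra.
- by rewrite xy (negPf yz); lra.
- by rewrite -yz (negPf xy); lra.
- by case: ifP => _; lra.
Qed.

HB.instance Definition _ := isMetric.Build R S
  sequence_distxx sequence_dist_positivity sequence_dist_sym
  sequence_dist_triangle.

Lemma sequence_sum_metrizable : metrizable R S.
Proof. by exists (Metric.class S). Qed.

Lemma sequence_sum_cvg i : (fun n => (i, Some n) : S) @ \oo -->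
  ((i, None) : S).
Proof.
move=> U /(@nbhs_ballP R S) [d /= d0 dU].
have [N _ Nd] := near_infty_natSinv_lt (PosNum d0).
exists N => // n /Nd /= nd; apply: dU.
rewrite (@ballEmdist R S) /= [mdist _ _]/(sequence_dist _ _).
by rewrite /sequence_dist; case: eqP => //= _; rewrite eqxx add0r.
Qed.

Lemma sequence_sum_isolated i n : nbhs ((i, Some n) : S) [set (i, Some n)].
Proof.
apply/(@nbhs_ballP R S).
(* The radius is the height of the point, a lower bound for its distance to every other point. *)
exists n.+1%:R^-1 => /=; first by rewrite invr_gt0.
move=> [j m]; rewrite (@ballEmdist R S) /= [mdist _ _]/(sequence_dist _ _).
rewrite /sequence_dist; case: eqP => [<-//|_] /=.
have /andP[m0 _] := height_itv m; case: eqP => _.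
  by rewrite ltNge lerDl m0.
by rewrite ltNge invf_le1 ?ltr0n ?ler1n.
Qed.

Lemma sequence_sum_continuous (T : topologicalType) (f : S -> T) :
  (forall i, f (i, Some n) @[n --> \oo] --> f (i, None)) -> continuous f.
Proof.
move=> fc [i [n|]] U.
  move=> /nbhs_singleton Ux; rewrite nbhs_simpl /=.
  by apply: filterS (sequence_sum_isolated i n) => _ ->.
move=> nU; have [N _ NU] := fc i U nU.
apply/(@nbhs_ballP R S).
(* A term of the same sequence in this ball has index above [N]; other sequences are at distance 1,
   not below the radius. *)
exists N.+1%:R^-1 => /=; first by rewrite invr_gt0.
move=> [j m]; rewrite (@ballEmdist R S) /= [mdist _ _]/(sequence_dist _ _).
case: m => [m|]; last first.
  rewrite /sequence_dist; case: eqP => [[<-] _|_ /=].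
    exact: nbhs_singleton.
  case: eqP => [<- _|_]; first exact: nbhs_singleton.
  by rewrite ltNge invf_le1 ?ltr0n ?ler1n.
rewrite /sequence_dist; case: eqP => //= _; case: eqP => [<-|_]; last first.
  by rewrite ltNge invf_le1 ?ltr0n ?ler1n.
rewrite add0r.
by rewrite ltf_pV2 ?posrE// ltr_nat => /ltnW Nm; exact: NU.
Qed.

End ConvergentSequences.

(** * First isomorphism theorem, and from (i) to (ii) *)

Definition kernel (F G : groupType) (p : F -> G)
  (pM : {morph p : x y / x * y}) : normal_subgroup F.
Proof.
exists [set x | p x = 1]; last first.
  by move=> x y /= px; rewrite /conjg !pM px mul1g -pM mulVg (morph1 pM).
split=> [|x y /= px py|x /= px]; first exact: (morph1 pM).
  by rewrite pM px py mulg1.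
by rewrite (morphV pM) px invg1.
Defined.

(** Continuity of [h] is left out: it amounts to openness of [p], and is derived later from the
    s-group property. *)
Lemma quotient_kernel (F G : topologicalGroupType) (p : F -> G)
    (pM : {morph p : x y / x * y}) :
  continuous p -> (forall y, exists x, p x = y) ->
  exists (k : quotient_group (kernel pM) -> G)
         (h : G -> quotient_group (kernel pM)),
    [/\ {morph k : x y / x * y}, cancel k h, cancel h k, continuous k &
        forall x, h (p x) = \pi_(quotient_group (kernel pM)) x].
Proof.
move=> pc /choice[r pr]; set Q := quotient_group _.
pose pi (x : F) : Q := \pi_Q x.
have piE x y : p x = p y -> pi x = pi y.
  move=> pxy; apply/eqmodP; apply/asboolP.
  by rewrite /= pM (morphV pM) pxy mulVg.
have pE x y : pi x = pi y -> p x = p y.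
  move=> /eqmodP/asboolP /=; rewrite pM (morphV pM) => pxy.
  by apply: (mulgI (p x)^-1); rewrite pxy mulVg.
have pi_repr (q : Q) : pi (repr q) = q by exact: reprK.
pose k (q : Q) : G := p (repr q).
have kpi x : k (pi x) = p x by apply: pE; rewrite pi_repr.
exists k, (pi \o r); split.
- move=> a b; rewrite -(pi_repr a) -(pi_repr b).
  by rewrite -[_ * _]quotient_piM !kpi pM.
- by move=> a; rewrite -(pi_repr a) kpi /=; apply: piE; rewrite pr.
- by move=> y; rewrite /= kpi pr.
- apply/(@quotient_continuous _ _ _ k).
  by rewrite (_ : _ \o _ = p)//; apply/funext => x; exact: kpi.
- by move=> x; apply: piE; rewrite pr.
Qed.

Lemma s_group_quotient (R : realType) (C : groupType -> Prop)
    (G : topologicalGroupType) :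
  residually_closed C -> C G -> s_group G ->
  exists (X : topologicalType) (e : X) (F : topologicalGroupType)
    (i : X -> F) (N : normal_subgroup F),
    [/\ metrizable R X,
        graev_free_in (fun H : topologicalGroupType => C H) e i &
        top_isomorphic (quotient_group N) G].
Proof.
move=> hC CG /s_groupP[hG fin].
pose P (u : nat -> G) := u @ \oo --> (1 : G).
pose I : choiceType := {classic {u | P u}}.
pose X : topologicalType := sequence_sum R I.
pose f (x : X) : G := if x.2 is Some n then sval (x.1 : {u | P u}) n else 1.
have fc : continuous f by apply: sequence_sum_continuous => -[u u1].
(* The constant sequence 1 is an index that always exists; its limit serves as base point. *)
have cst1 : (fun _ : nat => 1 : G) @ \oo --> (1 : G) by exact: cvg_cst.
pose e : X := (exist P _ cst1 : I, None).
have fe : f e = 1 by [].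
pose F : topologicalGroupType := graev_group C e.
pose p : F -> G := free_lift f.
have pM : {morph p : x y / x * y} by exact: free_liftM.
have pc : continuous p by exact: graev_lift_continuous.
pose i : X -> F := @free_gen C X e.
have pi x : p (i x) = f x by exact: free_lift_gen.
have psurj y : exists x, p x = y.
  have u1 : (fun n => if n is 0%N then y else 1) @ \oo --> (1 : G).
    by apply: cvg_near_cst; exists 1%N => // -[].
  by exists (i ((exist P _ u1 : I), Some 0%N)); rewrite pi.
have [k [h [kM kK hK kc hp]]] := quotient_kernel pM pc psurj.
exists X, e, F, i, (kernel pM); split.
- exact: sequence_sum_metrizable.
- exact: graev_groupP.
exists k, h; split=> //.
have hM : {morph h : x y / x * y}.
  by move=> a b; rewrite -{1}(hK a) -{1}(hK b) -kM kK.
(* Continuity of [h] means that [T] is coarser than [G]; [fin] gives this once [T] is Hausdorff and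
   keeps the sequences converging to 1. *)
pose T : topologicalType := initial_topology h.
apply/continuousP => A oA.
apply: (fin (Topological.class T) (initial_group_topology hM));
  last by exists A.
(* As [k] is continuous, [T] is finer than [G] and inherits its Hausdorff property. *)
- have idc : continuous (id : T -> G).
    rewrite (_ : id = k \o h); last first.
      by apply/funext => y /=; rewrite hK.
    move=> x; apply: (@continuous_comp T (quotient_group (kernel pM)) G h k).
      exact: initial_continuous.
    exact: kc.
  move=> x y xy; apply: hG => U V nU nV.
  by apply: xy; exact: idc.
- move=> u u1 U [B [[W oW <-] /= W1 WU]].
  apply: (filterS WU).
  pose s : I := exist P u u1.
  (* [h \o u] is the image of the [s]-th sequence of [X] under a continuous map, so it converges. *)
  have hu : (fun n => h (u n)) = (\pi_(quotient_group (kernel pM)) \o i) \o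
      (fun n => (s, Some n) : X).
    by apply/funext => n /=; rewrite -hp pi.
  have h1 : h 1 = (\pi_(quotient_group (kernel pM)) \o i) ((s, None) : X).
    by rewrite /= -hp pi.
  suff hu1 : h (u n) @[n --> \oo] --> h 1.
    by apply: (hu1 W); exact: open_nbhs_nbhs.
  rewrite hu h1; apply: continuous_cvg; last exact: sequence_sum_cvg.
  apply: (@continuous_comp X F (quotient_group (kernel pM)) i).
    exact: graev_gen_continuous.
  exact: pi_continuous.
Qed.

(** * The equivalences for general and for abelian groups *)

Lemma residually_closed_abelian : residually_closed abelian_group.
Proof.
move=> G sep x y; apply: sep => H f CH fM.
by rewrite !fM; exact: CH.
Qed.

(** Both halves of the theorem are instances, with [C] the class of all groups or of abelian
    groups. *)
Lemma s_group_tfae (R : realType) (C : groupType -> Prop)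
    (G : topologicalGroupType) :
  residually_closed C -> C G -> hausdorff_space G ->
  let quotient_of (P : topologicalType -> Prop) :=
    exists (X : topologicalType) (e : X) (F : topologicalGroupType)
      (i : X -> F) (N : normal_subgroup F),
      [/\ P X, graev_free_in (fun H : topologicalGroupType => C H) e i &
          top_isomorphic (quotient_group N) G] in
  [<-> s_group G;
       quotient_of (metrizable R);
       quotient_of (fun X => frechet_urysohn_space X /\ tychonoff_space X);
       quotient_of (fun X => sequential_space X /\ tychonoff_space X)].
Proof.
move=> hC CG hG quotient_of; tfae.
- exact: s_group_quotient.
- move=> [X [e [F [i [N [mX Fi NG]]]]]]; exists X, e, F, i, N; split=> //.
  split; first exact: metrizable_frechet_urysohn mX.
  exact: metrizable_tychonoff mX.
- move=> [X [e [F [i [N [[fX tX] Fi NG]]]]]]; exists X, e, F, i, N; split=> //.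
  by split=> //; exact: frechet_urysohn_sequential.
- move=> [X [e [F [i [N [[sX _] Fi NG]]]]]].
  exact: (sequential_quotient_s_group hC CG hG sX Fi NG).
Qed.

Theorem theorem1p19 (R : realType) (G : topologicalGroupType)
    (hG : hausdorff_space G) (nG : ~ discrete_space G) :
  [<-> s_group G;
       quotient_of_graev_free (metrizable R) G;
       quotient_of_graev_free
         (fun X => frechet_urysohn_space X /\ tychonoff_space X) G;
       quotient_of_graev_free
         (fun X => sequential_space X /\ tychonoff_space X) G]
  /\
  (abelian_group G ->
   [<-> s_group G;
        quotient_of_graev_free_abelian (metrizable R) G;
        quotient_of_graev_free_abelian
          (fun X => frechet_urysohn_space X /\ tychonoff_space X) G;
        quotient_of_graev_free_abelian
          (fun X => sequential_space X /\ tychonoff_space X) G]).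
Proof.
split=> [|aG]; first exact: (@s_group_tfae R (fun=> True)).
exact: (@s_group_tfae R abelian_group _ residually_closed_abelian).
Qed.
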